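(* Let $\Gamma_{\mathrm{DTE}}=(R,A,U)$ be the game in which the players are the robots $R=\{r_1,\dots,r_n\}$, the action set of robot $r_i$ is a minimal action set $A_i\subseteq\mathbf{P}_i$ (as defined in the context), $A=A_1\times\cdots\times A_n$, and the utilities are $U_i(\mathbf{p})=\sum_{\tau_j\in\tau}\left[v_j(\mathbf{c}_j(\mathbf{p}))-v_j(\mathbf{c}_j(\mathbf{p}_{-i}))\right]$. Let $f(\mathbf{p})=\sum_{\tau_j\in\tau}v_j(\mathbf{c}_j(\mathbf{p}))$. If all robots follow the Best Response (BR) algorithm in a repeated play of $\Gamma_{\mathrm{DTE}}$, generating the action profiles $\mathbf{p}(0),\mathbf{p}(1),\mathbf{p}(2),\dots$ from an arbitrary $\mathbf{p}(0)\in A$, then with probability one $$\lim_{k\to\infty} f(\mathbf{p}(k))\ \geq\ \frac{\max_{\mathbf{q}\in\mathbf{P}} f(\mathbf{q})}{\mathrm{PoA}(\Gamma_{\mathrm{DTE}})}.$$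
   Context: **Environment and trajectories.** $P=\{1,\dots,\bar x\}\times\{1,\dots,\bar y\}$ with $\bar x,\bar y\in\mathbb{Z}_+$ is a grid, $P_F\subseteq P$ is the set of feasible cells, and $S\subseteq P_F$ is the set of station cells. For $p=(x,y)\in P_F$, $N(p)=\{(x',y')\in P_F: |x'-x|\le 1,\ |y'-y|\le 1\}$. There are $n$ robots $R=\{r_1,\dots,r_n\}$; robot $r_i$ is assigned a station $\sigma_i\in S$ (several robots may share a station). With $T\in\mathbb{Z}_+$ the episode length, the set of feasible trajectories of $r_i$ is $\mathbf{P}_i=\{\mathbf{p}_i=(p_i^0,\dots,p_i^T): p_i^0=p_i^T=\sigma_i,\ p_i^{t+1}\in N(p_i^t)\ \forall t<T\}$, and $\mathbf{P}=\mathbf{P}_1\times\cdots\times\mathbf{P}_n$. **Tasks.** $\tau=\{\tau_1,\dots,\tau_m\}$ is a finite set of tasks, $\tau_j=(\ell_j,t^a_j,t^d_j,v_j)$, with location $\ell_j\in P_F$, arrival and departure times $t^a_j<t^d_j$ in $\{0,\dots,T\}$, and value function $v_j$. Tasks at the same location have non-overlapping windows: if $i\ne j$ and $\ell_i=\ell_j$ then $\min\{t^d_i,t^d_j\}\le\max\{t^a_i,t^a_j\}$. For $\mathbf{p}\in\mathbf{P}$, $c_j(\mathbf{p},t)=|\{r_k\in R: p_k^t=p_k^{t+1}=\ell_j\}|$ and $\mathbf{c}_j(\mathbf{p})=[c_j(\mathbf{p},t^a_j),\dots,c_j(\mathbf{p},t^d_j-1)]^{\mathsf T}$. The vector $\mathbf{c}_j(\mathbf{p}_{-i})$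 is defined in the same way but counting only robots in $R\setminus\{r_i\}$. The function $v_j$ maps such count vectors to $[0,\bar v_j]$, where $\bar v_j>0$ is the maximum value of the task, and is monotone: $\mathbf{c}\ge\mathbf{c}'$ entrywise implies $v_j(\mathbf{c})\ge v_j(\mathbf{c}')$. **Minimal action sets.** For $\mathbf{q}_i\in\mathbf{P}_i$ let $t^*(\mathbf{q}_i,\tau)=\{t: \exists\,\tau_j\in\tau,\ q_i^t=q_i^{t+1}=\ell_j,\ t^a_j\le t<t^d_j\}$. The action set $A_i$ is a minimum-cardinality set among all nonempty $A_i'\subseteq\mathbf{P}_i$ satisfying: for every $\mathbf{q}_i\in\mathbf{P}_i\setminus A_i'$ there is $\mathbf{p}_i\in A_i'$ such that $p_i^t=p_i^{t+1}=q_i^t$ for all $t\in t^*(\mathbf{q}_i,\tau)$. **Nash equilibria and price of anarchy.** $\mathbf{p}^*\in A$ is a Nash equilibrium if $U_i(\mathbf{p}^*_i,\mathbf{p}^*_{-i})=\max_{\mathbf{p}_i\in A_i}U_i(\mathbf{p}_i,\mathbf{p}^*_{-i})$ for all $i$. With $A^*\subseteq A$ the set of Nash equilibria, $\mathrm{PoA}(\Gamma_{\mathrm{DTE}})=\max_{\mathbf{p}\in A^*}f(\mathbf{p})\,/\min_{\mathbf{p}\in A^*}f(\mathbf{p})$ (the potential function of the game is $f$). If the denominator is $0$ and the numerator is positive, PoA is $+\infty$ (and division by it gives $0$); if both are $0$, PoA is $1$. **Best Response (BR) algorithm.** Start from an arbitrary $\mathbf{p}(0)\in A$. At each round $k=0,1,2,\dots$,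 pick a robot $r_i\in R$ uniformly at random (independently of the past); let $\mathrm{BR}(\mathbf{p}_{-i}(k))=\arg\max_{\mathbf{p}_i\in A_i}U_i(\mathbf{p}_i,\mathbf{p}_{-i}(k))$. If $\mathbf{p}_i(k)\in\mathrm{BR}(\mathbf{p}_{-i}(k))$, set $\mathbf{p}_i(k+1)=\mathbf{p}_i(k)$; otherwise let $\mathbf{p}_i(k+1)$ be a uniformly random element of $\mathrm{BR}(\mathbf{p}_{-i}(k))$. All other robots keep their actions: $\mathbf{p}_{-i}(k+1)=\mathbf{p}_{-i}(k)$. *)

(* Defs.v *)
From HB Require Import structures.
From mathcomp Require Import all_boot all_order all_algebra.
From mathcomp Require Import all_classical all_reals all_analysis.

Set Implicit Arguments.
Unset Strict Implicit.
Unset Printing Implicit Defensive.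

Import Order.TTheory GRing.Theory Num.Theory.
Import numFieldNormedType.Exports.

Local Open Scope ring_scope.

(* The value function is defined on all natural-number vectors of length       *)
(* t^d - t^a; entry s of a count vector refers to time t^a + s.                *)
Record task (R : realType) (cell : Type) := Task {
  loc : cell;
  arr : nat;
  dep : nat;
  vmax : R;
  value : {ffun 'I_(dep - arr) -> nat} -> R
}.

(* Grid coordinates are numbered from 0, i.e., the ordinal i stands for i + 1. *)
Record dte (R : realType) := DTE {
  xbar : nat;
  ybar : nat;
  feasible : {set 'I_xbar * 'I_ybar};
  stations : {set 'I_xbar * 'I_ybar};
  nrob : nat;
  station : 'I_nrob -> 'I_xbar * 'I_ybar;
  horizon : nat;
  ntask : nat;
  tasks : 'I_ntask -> task R ('I_xbar * 'I_ybar);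
  stations_feasible : stations \subset feasible;
  station_in : forall i, station i \in stations;
  loc_feasible : forall j, loc (tasks j) \in feasible;
  window_lt : forall j, (arr (tasks j) < dep (tasks j))%N;
  window_horizon : forall j, (dep (tasks j) <= horizon)%N;
  windows_disjoint : forall i j, i != j -> loc (tasks i) = loc (tasks j) ->
    (minn (dep (tasks i)) (dep (tasks j)) <=
     maxn (arr (tasks i)) (arr (tasks j)))%N;
  vmax_gt0 : forall j, 0 < vmax (tasks j);
  value_range : forall j c, 0 <= value (t := tasks j) c <= vmax (tasks j);
  vmax_attained : forall j, exists c, value (t := tasks j) c = vmax (tasks j);
  value_mono : forall j (c c' : {ffun 'I_(dep (tasks j) - arr (tasks j)) -> nat}),
    (forall s, (c' s <= c s)%N) -> value c' <= value c
}.

(* Both return 0 on the empty set; they are only used on nonempty sets.         *)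
Definition max_over (R : realType) (X : finType) (D : {set X}) (g : X -> R) : R :=
  if [pick x in D] is Some x0 then g [arg max_(x > x0 in D) g x]%O else 0.

Definition min_over (R : realType) (X : finType) (D : {set X}) (g : X -> R) : R :=
  if [pick x in D] is Some x0 then g [arg min_(x < x0 in D) g x]%O else 0.

Section Game.
Variables (R : realType) (E : dte R).

Definition cell := ('I_(xbar E) * 'I_(ybar E))%type.
Definition robot := 'I_(nrob E).
Definition traj := {ffun 'I_(horizon E).+1 -> cell}.
Definition profile := {ffun robot -> traj}.

Definition neighbors (c : cell) : {set cell} :=
  [set c' in feasible E |
    (`|(c'.1 : nat)%:Z - (c.1 : nat)%:Z| <= 1) &&
    (`|(c'.2 : nat)%:Z - (c.2 : nat)%:Z| <= 1)]%SET.

(* The position p^t; only used for t <= horizon. *)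
Definition pos (p : traj) (t : nat) : cell := p (inord t).

Definition trajs (i : robot) : {set traj} :=
  [set p : traj |
    [&& pos p 0 == station i, pos p (horizon E) == station i
      & [forall t : 'I_(horizon E), pos p t.+1 \in neighbors (pos p t)]]]%SET.

Definition stays (p : traj) (c : cell) (t : nat) : bool :=
  (pos p t == c) && (pos p t.+1 == c).

(* The count vector of task j when only the robots in Q are counted. *)
Definition counts_of (Q : {set robot}) (p : profile) (j : 'I_(ntask E)) :
    {ffun 'I_(dep (tasks j) - arr (tasks j)) -> nat} :=
  [ffun s : 'I_(dep (tasks j) - arr (tasks j)) =>
    #|[set k in Q | stays (p k) (loc (tasks j)) (arr (tasks j) + s)]%SET|].

Definition counts (p : profile) (j : 'I_(ntask E)) :=
  counts_of [set: robot]%SET p j.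

Definition counts_without (i : robot) (p : profile) (j : 'I_(ntask E)) :=
  counts_of [set~ i]%SET p j.

Definition welfare (p : profile) : R :=
  \sum_(j < ntask E) value (counts p j).

Definition utility (i : robot) (p : profile) : R :=
  \sum_(j < ntask E) (value (counts p j) - value (counts_without i p j)).

Definition tstar (q : traj) : {set 'I_(horizon E)} :=
  [set t : 'I_(horizon E) |
    [exists j : 'I_(ntask E), stays q (loc (tasks j)) t &&
      (arr (tasks j) <= t < dep (tasks j))%N]]%SET.

Definition adequate_actions (i : robot) (B : {set traj}) : Prop :=
  [/\ (0 < #|B|)%N, B \subset trajs i &
    forall q, q \in trajs i -> q \notin B ->
      exists2 p, p \in B & forall t, t \in tstar q -> stays p (pos q t) t].

Definition minimal_actions (i : robot) (B : {set traj}) : Prop :=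
  adequate_actions i B /\
  forall B' : {set traj}, adequate_actions i B' -> (#|B| <= #|B'|)%N.

Definition profiles (Act : robot -> {set traj}) : {set profile} :=
  [set p : profile | [forall i : robot, p i \in Act i]]%SET.

(* The profile (a, p_{-i}). *)
Definition deviate (p : profile) (i : robot) (a : traj) : profile :=
  [ffun k => if k == i then a else p k].

Variable Act : robot -> {set traj}.

Definition best_value (i : robot) (p : profile) : R :=
  max_over (Act i) (fun a => utility i (deviate p i a)).

Definition best_responses (i : robot) (p : profile) : {set traj} :=
  [set a in Act i | utility i (deviate p i a) == best_value i p]%SET.

Definition nash : {set profile} :=
  [set p in profiles Act |
    [forall i : robot, utility i p == best_value i p]]%SET.

Definition poa : \bar R :=
  let best := max_over nash welfare in
  let worst := min_over nash welfare in
  if worst == 0 then (if best == 0 then 1%E else +oo%E) else (best / worst)%:E.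

(* Probability that the next profile is q, when the current profile is p and   *)
(* robot i has been picked.                                                    *)
Definition br_step (i : robot) (p q : profile) : R :=
  if p i \in best_responses i p then (q == p)%:R
  else if [exists a in best_responses i p, q == deviate p i a]
       then (#|best_responses i p|%:R)^-1 else 0.

Variables (d : measure_display) (Omega : measurableType d).

(* The event that the profiles of rounds 0, ..., k and the robots picked at    *)
(* rounds 0, ..., k - 1 are the given ones.                                    *)
Definition history (pick : nat -> Omega -> robot) (X : nat -> Omega -> profile)
    (k : nat) (x : nat -> profile) (r : nat -> robot) : set Omega :=
  [set w | (forall l, (l <= k)%N -> X l w = x l) /\
           (forall l, (l < k)%N -> pick l w = r l)]%classic.

(* The conditional laws are stated in multiplied-out form, so that histories   *)
(* of probability 0 impose nothing.                                            *)
Record br_process (P : probability Omega R) (p0 : profile)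
    (pick : nat -> Omega -> robot) (X : nat -> Omega -> profile) : Prop := {
  pick_measurable : forall k i, measurable [set w | pick k w = i]%classic;
  play_measurable : forall k p, measurable [set w | X k w = p]%classic;
  play_init : forall w, X 0%N w = p0;
  pick_uniform : forall k x r i,
    P (history pick X k x r `&` [set w | pick k w = i])%classic =
    (P (history pick X k x r) * ((nrob E)%:R^-1)%:E)%E;
  play_step : forall k x r i q,
    P (history pick X k x r `&` [set w | pick k w = i]
       `&` [set w | X k.+1 w = q])%classic =
    (P (history pick X k x r `&` [set w | pick k w = i])%classic
       * (br_step i (x k) q)%:E)%E
}.

End Game.

(* Main.v *)
(* Since c_j(p_{-i}) does not depend on p_i, f is an exact potential. Hence a
   best-response round raises the expected value of f by the drift
   (1/n) sum_i (best value of i - U_i), which is nonnegative on A and vanishes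
   exactly at the Nash equilibria. As f is bounded, the total expected drift is
   finite, so the probability of sitting at a given non-equilibrium tends to 0,
   and almost surely an equilibrium is reached, where the play stays.
   Finally, replacing each q_i by the action that dominates it on t^*(q_i)
   can only increase the count vectors, so max_P f = max_A f; a maximizer of f
   over A is an equilibrium, so max_P f / PoA is the least equilibrium value of
   f (or 0, when that value is 0). *)
Require Import Defs.
From mathcomp Require Import all_boot all_order all_algebra.
From mathcomp Require Import all_classical all_reals all_analysis.

Import Order.TTheory GRing.Theory Num.Theory.
Import numFieldNormedType.Exports.

Local Open Scope classical_set_scope.
Local Open Scope ring_scope.

(** * Extrema over nonempty finite sets *)

Lemma max_over_attained {R : realType} {T : finType} {D : {set T}} (g : T -> R)
    {x0 : T} : x0 \in D ->
  exists2 x, x \in D & max_over D g = g x /\ {in D, forall y, g y <= g x}.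
Proof.
move=> x0D; rewrite /max_over; case: pickP => [x xD|/(_ x0)]; last by rewrite x0D.
by case: arg_maxP => // y yD max_y; exists y.
Qed.

Lemma min_over_attained {R : realType} {T : finType} {D : {set T}} (g : T -> R)
    {x0 : T} : x0 \in D ->
  exists2 x, x \in D & min_over D g = g x /\ {in D, forall y, g x <= g y}.
Proof.
move=> x0D; rewrite /min_over; case: pickP => [x xD|/(_ x0)]; last by rewrite x0D.
by case: arg_minP => // y yD min_y; exists y.
Qed.

Lemma le_max_over {R : realType} {T : finType} {D : {set T}} (g : T -> R) x :
  x \in D -> g x <= max_over D g.
Proof. by move=> xD; have [y _ [->]] := max_over_attained g xD; apply. Qed.

(** * The game: exact potential, best responses, equilibria and minimal action sets *)

Lemma deviate_self {R : realType} {E : dte R} (p : profile E) i :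
  deviate p i (p i) = p.
Proof. by apply/ffunP => k; rewrite ffunE; case: eqP => [->|]. Qed.

Lemma deviate_inj {R : realType} {E : dte R} (p : profile E) i :
  injective (deviate p i).
Proof. by move=> a b /ffunP/(_ i); rewrite !ffunE eqxx. Qed.

Lemma deviate_profiles {R : realType} {E : dte R} {Act : robot E -> {set traj E}}
    {p : profile E} {i a} :
  p \in profiles Act -> a \in Act i -> deviate p i a \in profiles Act.
Proof.
rewrite !inE => /forallP pA aA; apply/forallP => k.
by rewrite ffunE; case: eqP => [->|].
Qed.

Lemma counts_without_deviate {R : realType} {E : dte R} (p : profile E) i a j :
  counts_without i (deviate p i a) j = counts_without i p j.
Proof.
apply/ffunP => s; rewrite !ffunE; apply: eq_card => k; rewrite !inE ffunE.
by case: eqP.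
Qed.

Lemma utility_deviate {R : realType} {E : dte R} (p : profile E) i a :
  utility i (deviate p i a) - utility i p
    = welfare (deviate p i a) - welfare p.
Proof.
rewrite /utility /welfare -!sumrB; apply: eq_bigr => j _.
by rewrite counts_without_deviate opprB addrA addrNK.
Qed.

Lemma welfare_ge0 {R : realType} {E : dte R} (p : profile E) : 0 <= welfare p.
Proof. by apply: sumr_ge0 => j _; have /andP[] := value_range (counts p j). Qed.

Lemma utility_le_best {R : realType} {E : dte R} {Act : robot E -> {set traj E}}
    (p : profile E) i :
  p \in profiles Act -> utility i p <= best_value Act i p.
Proof.
rewrite inE => /forallP/(_ i) pA.
rewrite -[X in utility i X <= _](deviate_self p i).
exact: (le_max_over (fun a => utility i (deviate p i a))).
Qed.

Lemma best_responses_nonempty {R : realType} {E : dte R}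
    {Act : robot E -> {set traj E}} {p : profile E} i :
  p \in profiles Act -> (0 < #|best_responses Act i p|)%N.
Proof.
rewrite inE => /forallP/(_ i) pA.
have [a aA [bE _]] := max_over_attained (fun a => utility i (deviate p i a)) pA.
by apply/card_gt0P; exists a; rewrite inE aA /best_value bE eqxx.
Qed.

Lemma br_step_support {R : realType} {E : dte R} {Act : robot E -> {set traj E}}
    {i} {p q : profile E} :
  p \in profiles Act -> br_step Act i p q != 0 -> q \in profiles Act.
Proof.
rewrite /br_step => pA; case: ifP => _.
  by rewrite pnatr_eq0 eqb0 negbK => /eqP ->.
case: ifP => [/existsP[a /andP[]]|]; last by rewrite eqxx.
by rewrite inE => /andP[aA _] /eqP -> _; exact: deviate_profiles.
Qed.

(** All best responses of [i] give it the same utility, hence by the exact potential the same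
    welfare [c]. The expectation is therefore [c] times the total weight, which is one because
    distinct actions give distinct deviations. *)
Lemma br_step_welfare {R : realType} {E : dte R} {Act : robot E -> {set traj E}}
    i {p : profile E} : p \in profiles Act ->
  \sum_q br_step Act i p q * welfare q
    = welfare p + (best_value Act i p - utility i p).
Proof.
move=> pA; rewrite /br_step; have [|_] := boolP (p i \in _) => /=.
  rewrite inE deviate_self => /andP[_ /eqP ->]; rewrite subrr addr0.
  rewrite (bigD1 p) //= eqxx mul1r big1 ?addr0 // => q /negbTE ->.
  by rewrite mul0r.
set B := best_responses Act i p; set c := welfare p + _.
have -> : \sum_q (if [exists a in B, q == deviate p i a] then #|B|%:R^-1 else 0)
            * welfare q = \sum_(q in [set deviate p i a | a in B]%SET) #|B|%:R^-1 * c.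
  rewrite [RHS]big_mkcond; apply: eq_bigr => q _.
  have -> : [exists a in B, q == deviate p i a]
            = (q \in [set deviate p i a | a in B]%SET).
    apply/existsP/imsetP => [[a /andP[aB /eqP ->]]|[a aB ->]]; first by exists a.
    by exists a; rewrite aB eqxx.
  case: ifP => [/imsetP[a aB ->]|_]; last by rewrite mul0r.
  congr (_ * _); rewrite /c; move: aB; rewrite inE => /andP[_ /eqP <-].
  by rewrite utility_deviate addrC subrK.
rewrite sumr_const card_imset; last exact: deviate_inj.
rewrite -[LHS]mulr_natl mulrA divff ?mul1r // pnatr_eq0 -lt0n.
exact: best_responses_nonempty.
Qed.

Lemma nash_best_response {R : realType} {E : dte R} {Act : robot E -> {set traj E}}
    {p : profile E} i :
  p \in nash Act -> p i \in best_responses Act i p.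
Proof.
rewrite !inE => /andP[/forallP/(_ i) pA /forallP/(_ i)].
by rewrite deviate_self pA.
Qed.

(** A deviation that gained utility would raise the welfare above its maximum by the same amount. *)
Lemma argmax_welfare_nash {R : realType} {E : dte R}
    {Act : robot E -> {set traj E}} {p : profile E} :
  p \in profiles Act -> {in profiles Act, forall q, welfare q <= welfare p} ->
  p \in nash Act.
Proof.
move=> pA max_p; rewrite inE pA; apply/forallP => i.
rewrite eq_le utility_le_best //=.
have /forallP/(_ i) piA : [forall i, p i \in Act i] by move: pA; rewrite inE.
have [a aA [bE _]] := max_over_attained (fun a => utility i (deviate p i a)) piA.
rewrite /best_value bE -subr_le0 utility_deviate subr_le0.
exact/max_p/deviate_profiles.
Qed.

Lemma adequate_welfare {R : realType} {E : dte R} {Act : robot E -> {set traj E}}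
    (Act_ok : forall i, adequate_actions i (Act i)) {q : profile E} :
  q \in profiles (@trajs R E) ->
  exists2 p, p \in profiles Act & welfare q <= welfare p.
Proof.
rewrite inE => /forallP qP.
have pE i : {a | a \in Act i &
    forall t, t \in tstar (q i) -> stays a (pos (q i) t) t}.
  apply: cid2; have [_ _ ok] := Act_ok i.
  (* Adequacy speaks only of trajectories outside [Act i]; one inside dominates itself. *)
  have [qiA|qiA] := boolP (q i \in Act i); last exact: ok.
  exists (q i) => // t; rewrite inE /stays.
  by case/existsP=> j /andP[/andP[/eqP -> /eqP ->] _]; rewrite !eqxx.
exists [ffun i => s2val (pE i)].
  by rewrite inE; apply/forallP => i; rewrite ffunE; exact: (s2valP (pE i)).
apply: ler_sum => j _; apply: value_mono => s; rewrite !ffunE.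
apply/subset_leq_card/fintype.subsetP => k; rewrite !inE /= => stay_q.
(* Entry [s] of the count vector is time [arr + s], which lies in the window and below the horizon.
   So it belongs to [tstar (q k)], where the replacement of [q k] stays as well. *)
have lt_dep : (arr (tasks j) + s < dep (tasks j))%N by rewrite -ltn_subRL.
have lt_T := leq_trans lt_dep (window_horizon j).
have -> : loc (tasks j) = pos (q k) (arr (tasks j) + s).
  by case/andP: stay_q => /eqP.
rewrite ffunE; apply: (s2valP' (pE k) (Ordinal lt_T)).
by rewrite inE; apply/existsP; exists j; rewrite stay_q leq_addr.
Qed.

(** * From conditional laws given histories to the one-step law of the play *)

Lemma probability_partition {d : measure_display} {Omega : measurableType d}
    {R : realType} (P : probability Omega R) {T : finType} {Z : Omega -> T}
    {A : set Omega} :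
  measurable A -> (forall z, measurable [set w | Z w = z]) ->
  P A = (\sum_z P (A `&` [set w | Z w = z]))%E.
Proof.
move=> mA mZ.
have {1}-> : A = \bigcup_(z in [set: T]) (A `&` [set w | Z w = z]).
  by rewrite -setI_bigcupr setIidl // => w _; exists (Z w).
rewrite measure_fin_bigcup.
- rewrite (fsbigE (index_enum T)) ?index_enum_uniq // => [|z _].
    by apply: eq_bigl => z; rewrite in_setT.
  by rewrite mem_index_enum.
- exact: finite_finset.
- by move=> z z' _ _ [w [[_ /= <-] [_ /= <-]]].
- by move=> z _; exact: measurableI.
Qed.

Lemma measurable_finite_preimage {d : measure_display}
    {Omega : measurableType d} {T : finType} {Z : Omega -> T} (A : set T) :
  (forall z, measurable [set w | Z w = z]) -> measurable (Z @^-1` A).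
Proof.
move=> mZ; have -> : Z @^-1` A = \bigcup_(z in A) [set w | Z w = z].
  by apply/seteqP; split=> [w Aw|w [z Az /= ->]//]; exists (Z w).
by apply: fin_bigcup_measurable => //; exact: finite_finset.
Qed.

Lemma history_measurable {R : realType} {E : dte R} {d : measure_display}
    {Omega : measurableType d} {pick : nat -> Omega -> robot E}
    {X : nat -> Omega -> profile E} k x r :
  (forall l i, measurable [set w | pick l w = i]) ->
  (forall l p, measurable [set w | X l w = p]) ->
  measurable (history pick X k x r).
Proof.
move=> mpick mX; have -> : history pick X k x r =
    (\bigcap_(l in `I_k.+1) [set w | X l w = x l]) `&`
    (\bigcap_(l in `I_k) [set w | pick l w = r l]).
  by apply/seteqP; split=> [w []|w []].
by apply: measurableI; apply: fin_bigcap_measurable => //; exact: finite_II.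
Qed.

(** The source of the Markov property: [X k = p] is a finite disjoint union of histories ending at
    [p], and a conditional probability [c] common to all of them survives summation. *)
Lemma history_condition {R : realType} {E : dte R} {d : measure_display}
    {Omega : measurableType d} {P : probability Omega R}
    {pick : nat -> Omega -> robot E} {X : nat -> Omega -> profile E}
    {k} {p : profile E} {B C : set Omega} {c : R} :
  (forall l i, measurable [set w | pick l w = i]) ->
  (forall l q, measurable [set w | X l w = q]) ->
  measurable B -> measurable C ->
  (forall x r, x k = p -> P (history pick X k x r `&` B `&` C)
     = (P (history pick X k x r `&` B) * c%:E)%E) ->
  P ([set w | X k w = p] `&` B `&` C)
    = (P ([set w | X k w = p] `&` B) * c%:E)%E.
Proof.
move=> mpick mX mB mC cond.
(* [Z] records the history up to round [k] in a finite type, so its fibres partition the sample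
   space. *)
pose Z w : {ffun 'I_k.+1 -> profile E} * {ffun 'I_k -> robot E} :=
  ([ffun l : 'I_k.+1 => X l w], [ffun l : 'I_k => pick l w]).
have Zhist w0 : [set w | Z w = Z w0] = history pick X k (X^~ w0) (pick^~ w0).
  apply/seteqP; split=> w /= => [[/ffunP eqX /ffunP eqp]|[eqX eqp]].
    split=> l ltl; first by have := eqX (Ordinal (ltl : (l < k.+1)%N)); rewrite !ffunE.
    by have := eqp (Ordinal ltl); rewrite !ffunE.
  by congr pair; apply/ffunP => l; rewrite !ffunE ?eqX ?eqp // -ltnS.
(* A point [w0] of a nonempty fibre supplies the infinite sequences that [history] takes as
   arguments. *)
have Zcase z : [set w | Z w = z] = set0 \/ exists w0, z = Z w0.
  have [->|/set0P[w0 /= <-]] := eqVneq [set w | Z w = z] set0; first by left.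
  by right; exists w0.
have mZ z : measurable [set w | Z w = z].
  by case: (Zcase z) => [->//|[w0 ->]]; rewrite Zhist; exact: history_measurable.
rewrite (probability_partition P _ mZ); last by do 2?apply: measurableI.
rewrite (probability_partition P (A := _ `&` B) _ mZ); last exact: measurableI.
rewrite ge0_sume_distrl => [|z _]; last exact: measure_ge0.
apply: eq_bigr => z _; case: (Zcase z) => [->|[w0 ->]].
  by rewrite !setI0 measure0 mul0e.
rewrite Zhist; have [Xp|Xp] := eqVneq (X k w0) p; last first.
  have H0 D : [set w | X k w = p] `&` D
      `&` history pick X k (X^~ w0) (pick^~ w0) = set0.
    apply/seteqP; split=> // w [[/= Xw _] [/(_ k (leqnn k)) Xw0 _]].
    by move/eqP: Xp; rewrite -Xw0 Xw.
  by rewrite -(setIA _ B C) !H0 measure0 mul0e.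
have HB D : [set w | X k w = p] `&` D `&` history pick X k (X^~ w0) (pick^~ w0)
    = history pick X k (X^~ w0) (pick^~ w0) `&` D.
  apply/seteqP; split=> w => [[[_ ?] ?]//|[Hw Dw]]; do 2?split=> //.
  by case: Hw => /(_ k (leqnn k)) /= ->.
by rewrite -(setIA _ B C) !HB setIA cond.
Qed.

(** Both laws of [br_process] are averaged over histories: first the play given the pick, then, with
    the whole space as [B], the pick itself. *)
Lemma br_transition {R : realType} {E : dte R} {Act : robot E -> {set traj E}}
    {d : measure_display} {Omega : measurableType d} {P : probability Omega R}
    {p0 : profile E} {pick : nat -> Omega -> robot E}
    {X : nat -> Omega -> profile E} (X_br : br_process Act P p0 pick X) k p i q :
  P ([set w | X k w = p] `&` [set w | pick k w = i] `&` [set w | X k.+1 w = q])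
  = (P [set w | X k w = p] * ((nrob E)%:R^-1 * br_step Act i p q)%:E)%E.
Proof.
have [mpick mX _ uni step] := X_br.
rewrite (history_condition (c := br_step Act i p q) mpick mX (mpick k i) (mX _ _)).
  rewrite -[X in P (X `&` _)]setIT.
  rewrite (history_condition (c := (nrob E)%:R^-1) mpick mX measurableT (mpick k i)).
    by rewrite setIT EFinM muleA.
  by move=> x r _; rewrite setIT uni.
by move=> x r <-; exact: step.
Qed.

(** The play is a Markov chain whose kernel averages [br_step] over the robots. Real-valued masses
    put it in the form that [drift_transient] takes. *)
Lemma br_law {R : realType} {E : dte R} {Act : robot E -> {set traj E}}
    {d : measure_display} {Omega : measurableType d} {P : probability Omega R}
    {p0 : profile E} {pick : nat -> Omega -> robot E}
    {X : nat -> Omega -> profile E} (X_br : br_process Act P p0 pick X) k q :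
  fine (P [set w | X k.+1 w = q]) =
  \sum_p fine (P [set w | X k w = p])
    * \sum_i (nrob E)%:R^-1 * br_step Act i p q.
Proof.
have [mpick mX _ _ _] := X_br.
have finP p : P [set w | X k w = p] = (fine (P [set w | X k w = p]))%:E.
  by rewrite fineK // fin_num_measure.
have -> : P [set w | X k.+1 w = q] =
    (\sum_p fine (P [set w | X k w = p])
       * \sum_i (nrob E)%:R^-1 * br_step Act i p q)%:E; last by [].
rewrite (probability_partition P (mX _ _) (mX k)) -sumEFin.
apply: eq_bigr => p _.
rewrite (probability_partition P (measurableI _ _ (mX _ _) (mX _ _)) (mpick k)).
rewrite mulr_sumr -sumEFin; apply: eq_bigr => i _.
by rewrite -setIA setIC (br_transition X_br) [in LHS]finP.
Qed.

(** * Absorption at equilibria and almost sure arrival there *)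

Lemma br_absorbed {R : realType} {E : dte R} {Act : robot E -> {set traj E}}
    {d : measure_display} {Omega : measurableType d} {P : probability Omega R}
    {p0 : profile E} {pick : nat -> Omega -> robot E}
    {X : nat -> Omega -> profile E} (X_br : br_process Act P p0 pick X) :
  {ae P, forall w, forall k, X k w \in nash Act -> X k.+1 w = X k w}.
Proof.
have [mpick mX _ _ _] := X_br.
apply: ae_foralln => k.
(* For fixed [k] only finitely many pairs of profiles occur, so it is enough that each single move
   away from an equilibrium is null. It is: at an equilibrium every robot already plays a best
   response and [br_step] keeps the profile. *)
suff : {ae P, forall w, forall pq : profile E * profile E, pq.1 \in nash Act ->
    pq.1 != pq.2 -> ~ (X k w = pq.1 /\ X k.+1 w = pq.2)}.
  apply: filterS => w /(_ (X k w, X k.+1 w)) /= H Xk.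
  by have [|/(H Xk)/(_ (conj erefl erefl))] := eqVneq (X k w) (X k.+1 w).
apply: filter_forall => -[p q] /=.
have [pN|_] := boolP (p \in nash Act); last exact: filterE.
have [_|npq] := eqVneq p q; first exact: filterE.
exists ([set w | X k w = p] `&` [set w | X k.+1 w = q]); split.
- exact: measurableI.
- rewrite (probability_partition P (measurableI _ _ (mX _ _) (mX _ _)) (mpick k)).
  rewrite big1 // => i _; rewrite setIAC (br_transition X_br) /br_step.
  by rewrite nash_best_response // eq_sym (negbTE npq) mulr0 mule0.
- by move=> w /= /not_implyP[_] /not_implyP[_] /contrapT.
Qed.

(* The expectation of [f] telescopes, so the expected total drift is bounded. *)
Lemma drift_transient {R : realType} {T : finType} {m : nat -> T -> R}
    {K : T -> T -> R} {A : {set T}} {f g : T -> R} :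
  (forall k p, 0 <= m k p <= 1) ->
  (forall k q, m k.+1 q = \sum_p m k p * K p q) ->
  (forall k p, p \notin A -> m k p = 0) ->
  (forall p, 0 <= f p) -> {in A, forall p, 0 <= g p} ->
  {in A, forall p, \sum_q K p q * f q = f p + g p} ->
  forall p, 0 < g p -> m k p @[k --> \oo] --> 0.
Proof.
move=> m01 mS mA f0 g0 drift p gp.
have [pA|pA] := boolP (p \in A); last first.
  by under eq_fun => k do rewrite mA //; exact: cvg_cst.
(* [a k] is the expectation of [f] under the law [m k]. *)
pose a k := \sum_q m k q * f q.
have aS k : a k.+1 = a k + \sum_q m k q * g q.
  rewrite /a -big_split /=.
  under eq_bigr => q _ do rewrite mS mulr_suml.
  rewrite exchange_big; apply: eq_bigr => q _ /=.
  under eq_bigr => q' _ do rewrite -mulrA.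
  rewrite -mulr_sumr -mulrDr; have [/drift -> //|/mA ->] := boolP (q \in A).
  by rewrite !mul0r.
have mg0 k q : 0 <= m k q * g q.
  have [qA|/mA ->] := boolP (q \in A); last by rewrite mul0r.
  by have /andP[m0 _] := m01 k q; rewrite mulr_ge0 ?g0.
have le_a N : series (fun k => m k p * g p) N <= a N.
  rewrite /series /=; elim: N => [|N IH].
    rewrite big_geq // sumr_ge0 // => q _.
    by have /andP[m0 _] := m01 0%N q; rewrite mulr_ge0.
  rewrite big_nat_recr //= aS lerD // (bigD1 p) //= lerDl sumr_ge0 // => q _.
have /cvg_series_cvg_0 u0 : cvgn (series (fun k => m k p * g p)).
  apply: nondecreasing_is_cvgn.
    exact: nondecreasing_series.
  (* This crude bound on all [a N] only uses that every mass is at most 1. *)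
  exists (\sum_q f q) => _ [N _ <-]; apply: (le_trans (le_a N)).
  by apply: ler_sum => q _; have /andP[_ m1] := m01 N q; rewrite ler_piMl.
have -> : m ^~ p = (fun k => m k p * g p * (g p)^-1).
  by apply/funext => k; rewrite mulfK // gt_eqF.
by rewrite -[X in _ --> X](mul0r (g p)^-1); apply: cvgMl.
Qed.

Lemma br_reaches_nash {R : realType} {E : dte R} {Act : robot E -> {set traj E}}
    {d : measure_display} {Omega : measurableType d} {P : probability Omega R}
    {p0 : profile E} {pick : nat -> Omega -> robot E}
    {X : nat -> Omega -> profile E} :
  p0 \in profiles Act -> br_process Act P p0 pick X ->
  {ae P, forall w, exists k, X k w \in nash Act}.
Proof.
move=> p0A X_br; have [mpick mX X0 _ _] := X_br.
pose m k p := fine (P [set w | X k w = p]).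
have finP A : measurable A -> P A = (fine (P A))%:E.
  by move=> mA; rewrite fineK // fin_num_measure.
have m01 k p : 0 <= m k p <= 1.
  by rewrite -!lee_fin -finP // measure_ge0 probability_le1.
have mA k p : p \notin profiles Act -> m k p = 0.
  elim: k p => [|k IH] p pA.
    rewrite /m (_ : [set w | _] = set0) ?measure0 //.
    by apply/seteqP; split=> // w /=; rewrite X0 => pE; move: pA; rewrite -pE p0A.
  rewrite /m (br_law X_br) big1 // => q _.
  have [qA|/IH] := boolP (q \in profiles Act); last by rewrite /m => ->; rewrite mul0r.
  rewrite big1 ?mulr0 // => i _; apply/eqP; rewrite mulf_eq0 orbC.
  by apply/orP; left; apply: contraNT pA; exact: br_step_support.
(* Total mass 1 makes the sample space nonempty, and any pick at a sample point is a robot. *)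
have nrob_gt0 : (0 < nrob E)%N.
  have /set0P[w _] : [set: Omega] != set0.
    apply/eqP => O0; have := probability_setT P.
    by rewrite O0 measure0 => /eqP; rewrite eqe eq_sym oner_eq0.
  exact: leq_ltn_trans (leq0n _) (ltn_ord (pick 0%N w)).
pose g (p : profile E) :=
  \sum_i (nrob E)%:R^-1 * (best_value Act i p - utility i p).
have g_term p i : p \in profiles Act ->
    0 <= (nrob E)%:R^-1 * (best_value Act i p - utility i p).
  by move=> pA; rewrite mulr_ge0 ?invr_ge0 // subr_ge0 utility_le_best.
have transient p : p \notin nash Act -> m k p @[k --> \oo] --> 0.
  have [pA|pA] := boolP (p \in profiles Act); last first.
    by under eq_fun => k do rewrite mA //; move=> _; exact: cvg_cst.
  (* Some robot [i] can improve at [p]; its term alone makes the drift [g p] positive. *)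
  rewrite inE pA => /forallPn[i ne].
  apply: (drift_transient (A := profiles Act) (f := @welfare R E) (g := g)
            m01 (br_law X_br) mA) => //.
  - exact: welfare_ge0.
  - by move=> q qA; apply: sumr_ge0 => j _; exact: g_term.
  - move=> q qA; under eq_bigr => q' _ do rewrite mulr_suml.
    rewrite exchange_big /=.
    under eq_bigr => j _.
      under eq_bigr => q' _ do rewrite -mulrA.
      rewrite -mulr_sumr br_step_welfare // mulrDr.
      over.
    rewrite big_split /= sumr_const card_ord; congr (_ + _).
    rewrite -[LHS]mulr_natr mulrAC mulVf ?mul1r //.
    by rewrite pnatr_eq0 -lt0n.
  - rewrite /g (bigD1 i) //= ltr_pwDl ?sumr_ge0 // => [|j _]; last exact: g_term.
    by rewrite mulr_gt0 ?invr_gt0 ?ltr0n // subr_gt0 lt_neqAle ne utility_le_best.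
(* [N] is the event that no equilibrium is ever visited. For every [k] its probability is at most
   the mass that [m k] puts on non-equilibria, a finite sum of sequences tending to 0. *)
pose N := \bigcap_k (X k @^-1` [set p | p \notin nash Act]).
have mN : measurable N.
  by apply: bigcapT_measurable => k; exact: measurable_finite_preimage.
exists N; split=> //; last first.
  by move=> w /= /forallNP H k _ /=; apply/negP; exact: H.
suff : (P N <= 0)%E by rewrite measure_le0 => /eqP.
rewrite finP // lee_fin.
have le_m k : fine (P N) <= \sum_(p | p \notin nash Act) m k p.
  rewrite -lee_fin -finP // (probability_partition P mN (mX k)) -sumEFin.
  rewrite [leRHS]big_mkcond; apply: lee_sum => p _; case: ifPn => [_|pN].
    by rewrite /m -finP // measureIr.
  rewrite (_ : _ `&` _ = set0) ?measure0 //.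
  by apply/seteqP; split=> // w [/(_ k I) /= + /= Xp]; rewrite Xp (negbTE pN).
have sum0 : \sum_(p | p \notin nash Act) m k p @[k --> \oo] --> (0 : R).
  rewrite [X in _ --> X](_ : 0 = \sum_(p : profile E | p \notin nash Act) 0).
    by apply: cvg_big transient; exact: add_continuous.
  by rewrite big1.
by rewrite -(cvg_lim _ sum0) //; apply: limr_ge; [exact: cvgP sum0|exact: nearW].
Qed.

Theorem theorem1 (R : realType) (E : dte R) (Act : robot E -> {set traj E})
    (Act_minimal : forall i, minimal_actions i (Act i))
    (d : measure_display) (Omega : measurableType d) (P : probability Omega R)
    (p0 : profile E) (p0_Act : p0 \in profiles Act)
    (pick : nat -> Omega -> robot E) (X : nat -> Omega -> profile E)
    (X_br : br_process Act P p0 pick X) :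
  {ae P, forall w, exists2 l : R,
    (fun k => welfare (X k w)) @ \oo --> l &
    ((max_over (profiles (@trajs R E)) (@welfare R E))%:E / poa Act
       <= l%:E)%E}.
Proof.
apply: filterS2 (br_reaches_nash p0_Act X_br) (br_absorbed X_br).
move=> w [K XK] absorbed; exists (welfare (X K w)).
  have XE n : X (n + K)%N w = X K w.
    by elim: n => // n IH; rewrite addSn absorbed IH.
  apply: cvg_near_cst; exists K => // n /= leKn.
  by rewrite -(subnK leKn) XE.
(* The profile [X K w] witnesses that the set of equilibria is nonempty, so the extrema in [poa] are
   attained and the default 0 does not occur. *)
have [b bA [_ max_b]] := max_over_attained (@welfare R E) p0_Act.
have bN := argmax_welfare_nash bA max_b.
have [b' b'N [bestE max_b']] := max_over_attained (@welfare R E) XK.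
have [c cN [worstE min_c]] := min_over_attained (@welfare R E) XK.
have nashA q : q \in nash Act -> q \in profiles Act by rewrite inE => /andP[].
have -> : max_over (profiles (@trajs R E)) (@welfare R E)
        = max_over (nash Act) (@welfare R E).
  have AT p : p \in profiles Act -> p \in profiles (@trajs R E).
    rewrite !inE => /forallP pA; apply/forallP => i.
    by have [[_ /fintype.subsetP sub _] _] := Act_minimal i; exact: sub.
  have [q qT [-> max_q]] := max_over_attained (@welfare R E) (AT _ bA).
  have [p pA le_qp] := adequate_welfare (fun i => (Act_minimal i).1) qT.
  rewrite bestE; apply/eqP; rewrite eq_le (le_trans le_qp) /=.
    exact/max_q/AT/nashA.
  exact: le_trans (max_b _ pA) (max_b' _ bN).
rewrite /poa bestE worstE.
(* If the worst equilibrium value is 0, the quotient is 0: either the numerator is 0, or the price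
   of anarchy is infinite with inverse 0. Otherwise it simplifies to [welfare c], the worst
   equilibrium value. *)
have [c0|c_neq0] := eqVneq (welfare c) 0.
  have [->|_] := eqVneq (welfare b') 0; first by rewrite mul0e lee_fin welfare_ge0.
  by rewrite invey mule0 lee_fin welfare_ge0.
have c_gt0 : 0 < welfare c by rewrite lt_def c_neq0 welfare_ge0.
have b'_gt0 : 0 < welfare b' by apply: lt_le_trans c_gt0 (min_c _ b'N).
rewrite inver mulf_eq0 invr_eq0 !gt_eqF //= -EFinM lee_fin.
by rewrite invf_div mulrCA divff ?mulr1 ?gt_eqF // min_c.
Qed.
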